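(* In the setting of the context, assume that the matrix-valued coefficients satisfy: (i) the matrices $I+\underline\sigma_{i+1/2}$ and $\big(1+\frac{2\varepsilon b}{\Delta x}\big)I+\underline\sigma_{i+1/2}$ are invertible for all $\varepsilon\in[0,1]$; (ii) there exists an $n\times n$ matrix $\mathcal M_{i+1/2}$ with $Q(I+\underline\sigma_{i+1/2})^{-1}=\frac1{b^2}\mathcal M_{i+1/2}Q$; (iii) $\mathcal M_{i+1/2}=\mathcal M(u)+O(\Delta x)$ at each interface $x_{i+1/2}$, where $\mathcal M(u)$ is the matrix of the effective system $\partial_tu=\partial_x(\mathcal M(u)\partial_xu)$. Then the effective system associated with the finite volume scheme coincides with the effective system of the late-time/stiff relaxation framework. That is, if the solutions of the $\varepsilon$-scheme of the context admit (for fixed $\Delta t,\Delta x$, as $\varepsilon\to0$) expansions $U_i^m=\mathcal E(u_i^m)+\varepsilon(U_1)_i^m+O(\varepsilon^2)$, then $$\frac1{\Delta t}(u_i^{m+1}-u_i^m)=\frac1{\Delta x^2}\Big(\mathcal M_{i+1/2}(u_{i+1}^m-u_i^m)+\mathcal M_{i-1/2}(u_{i-1}^m-u_i^m)\Big),$$ and this is a conservative discretization consistent with $\partial_tu=\partial_x(\mathcal M(u)\partial_xu)$: for smooth $u$, its discrete flux satisfies $\mathcal M_{i+1/2}\,\frac{u(x_{i+1})-u(x_i)}{\Delta x}=\mathcal M(u)\,\partial_xu+O(\Delta x)$ at $x_{i+1/2}$.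
   Context: Let $\Omega\subset\mathbb R^N$ be open and convex, $F,R:\Omega\to\mathbb R^N$ smooth, $A=D_UF$ (with real eigenvalues and a full basis of eigenvectors), $B=D_UR$. Assume: Condition 1: $Q$ is a constant $n\times N$ matrix of rank $n<N$ with $QR(U)=0$ on $\Omega$; $\omega=Q\Omega\subset\mathbb R^n$. Condition 2: $\mathcal E:\omega\to\Omega$ is smooth with $R(\mathcal E(u))=0$, $Q\mathcal E(u)=u$. Condition 3: $QF(\mathcal E(u))=0$ for all $u\in\omega$. Condition 4: for all $u\in\omega$, $\dim\ker B(\mathcal E(u))=n$ and $\ker B(\mathcal E(u))\cap\operatorname{Im}B(\mathcal E(u))=\{0\}$. The effective system of the late-time/stiff relaxation framework is $\partial_tu=-\partial_x(QA(\mathcal E(u))U_1)=\partial_x(\mathcal M(u)\partial_xu)$, where $U_1$ is the unique solution of $B(\mathcal E(u))U_1=-A(\mathcal E(u))\partial_x(\mathcal E(u))$, $QU_1=0$, and the $n\times n$ matrix $\mathcal M(u)$ is defined by $-QA(\mathcal E(u))U_1=\mathcal M(u)\partial_xu$. The $\varepsilon$-scheme, on a uniform mesh (cell length $\Delta x$, centers $x_i$, interfaces $x_{i+1/2}$, time step $\Delta t$, constant $b>0$), for the system $\varepsilon\partial_tU+\partial_xF(U)=-R(U)/\varepsilon$, is $$\frac{\varepsilon}{\Delta t}(U_i^{m+1}-U_i^m)+\frac1{\Delta x}\big(\underline\alpha_{i+1/2}F^{HLL}_{i+1/2}-\underline\alpha_{i-1/2}F^{HLL}_{i-1/2}\big)=\frac1{\Delta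 x}\big(\underline\alpha_{i+1/2}-\underline\alpha_{i-1/2}\big)F(U_i^m)-\frac1{2\varepsilon}\big(\underline\alpha_{i+1/2}+\underline\alpha_{i-1/2}\big)R(U_i^m),$$ with $$F^{HLL}_{i+1/2}=\tfrac12\big(F(U_i^m)+F(U_{i+1}^m)\big)-\tfrac b2(U_{i+1}^m-U_i^m),\qquad \underline\alpha_{i+1/2}=\Big(I+\tfrac{\Delta x}{2\varepsilon b}(I+\underline\sigma_{i+1/2})\Big)^{-1},$$ where $\underline\sigma_{i+1/2}$ are $N\times N$ parameter matrices not depending on $\varepsilon$. *)

(* Defs.v *)
From HB Require Import structures.
From mathcomp Require Import all_boot all_order all_algebra.
From mathcomp Require Import all_classical all_reals all_analysis.

Set Implicit Arguments.
Unset Strict Implicit.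
Unset Printing Implicit Defensive.

Import Order.TTheory GRing.Theory Num.Theory.
Import numFieldNormedType.Exports.

Local Open Scope classical_set_scope.
Local Open Scope ring_scope.

(* [Ck_on k D f] is only meant for an open set D and a finite-dimensional V,
   where it is the usual class C^k: f is differentiable and its directional
   derivatives along all fixed vectors are C^(k-1). *)
Fixpoint Ck_on (R : realType) (V W : normedModType R) (k : nat)
    (D : set V) (f : V -> W) : Prop :=
  match k with
  | 0 => forall x, D x -> {for x, continuous f}
  | k'.+1 => (forall x, D x -> differentiable f x) /\
             (forall v : V, Ck_on k' D (fun x => 'D_v f x))
  end.

Definition smooth_on (R : realType) (V W : normedModType R)
    (D : set V) (f : V -> W) : Prop :=
  forall k : nat, Ck_on k D f.

(* The library's ['J f x] is for row vectors; this is its counterpart for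
   column vectors: ['d f x v = jac f x *m v], with (i, j) entry df_i/dx_j. *)
Definition jac (R : realType) (p q : nat)
    (f : 'cV[R]_p -> 'cV[R]_q) (x : 'cV[R]_p) : 'M[R]_(q, p) :=
  \matrix_(i, j) ('d f x (delta_mx j 0)) i 0.

Section Relaxation.
Variables (R : realType) (n N : nat).
Implicit Types (F S : 'cV[R]_N -> 'cV[R]_N) (E : 'cV[R]_n -> 'cV[R]_N).
Implicit Types (Q : 'M[R]_(n, N)) (Omega : set 'cV[R]_N).

Definition omega Omega Q : set 'cV[R]_n := [set Q *m U | U in Omega].

(* The vectors p below stand for the values of d_x u at a point where the
   state is u; by the chain rule, d_x (E(u)) = jac E u *m p there. *)
Definition is_first_corrector F S E Q (u p : 'cV[R]_n) (U1 : 'cV[R]_N) : Prop :=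
  jac S (E u) *m U1 = - (jac F (E u) *m (jac E u *m p)) /\ Q *m U1 = 0.

(* Under conditions 1-4 below and for u in omega, [is_first_corrector] has
   exactly one solution U1, linear in p, so that both uses of [get] pick the
   unique element of a singleton. *)
Definition first_corrector F S E Q (u p : 'cV[R]_n) : 'cV[R]_N :=
  get (fun U1 => is_first_corrector F S E Q u p U1).

Definition effective_mx F S E Q (u : 'cV[R]_n) : 'M[R]_n :=
  get (fun M : 'M[R]_n => forall p : 'cV[R]_n,
    - (Q *m (jac F (E u) *m first_corrector F S E Q u p)) = M *m p).

Definition condition1 Omega S Q : Prop :=
  [/\ (n < N)%N, \rank Q = n & forall U, Omega U -> Q *m S U = 0].

Definition condition2 Omega S E Q : Prop :=
  smooth_on (omega Omega Q) E /\
  forall u, omega Omega Q u -> [/\ Omega (E u), S (E u) = 0 & Q *m E u = u].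

Definition condition3 Omega F E Q : Prop :=
  forall u, omega Omega Q u -> Q *m F (E u) = 0.

(* The row spaces of [kermx B^T] and [B^T] are the transposes of the kernel and
   of the image of B acting on column vectors. *)
Definition condition4 Omega S E Q : Prop :=
  forall u, omega Omega Q u -> let B := jac S (E u) in
    \rank (kermx B^T) = n /\ (kermx B^T :&: B^T)%MS = 0.

(* Grid arrays: the value at index (m, i) of a cell quantity is the value at
   time level m in the cell of center x_i; for interface quantities (sigma and
   M below), index (m, i) refers to time level m and interface x_{i+1/2}. *)

Definition hll_flux F (b : R) (Ul Ur : 'cV[R]_N) : 'cV[R]_N :=
  2^-1 *: (F Ul + F Ur) - (b / 2) *: (Ur - Ul).

Definition alpha_mx (b dx eps : R) (sigma : 'M[R]_N) : 'M[R]_N :=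
  invmx (1%:M + (dx / (2 * eps * b)) *: (1%:M + sigma)).

Definition eps_scheme F S (b dx dt eps : R) (sigma : nat -> int -> 'M[R]_N)
    (U : nat -> int -> 'cV[R]_N) : Prop :=
  forall (m : nat) (i : int),
    let ar := alpha_mx b dx eps (sigma m i) in
    let al := alpha_mx b dx eps (sigma m (i - 1)) in
    (eps / dt) *: (U m.+1 i - U m i)
    + dx^-1 *: (ar *m hll_flux F b (U m i) (U m (i + 1))
                - al *m hll_flux F b (U m (i - 1)) (U m i))
    = dx^-1 *: ((ar - al) *m F (U m i))
      - (2 * eps)^-1 *: ((ar + al) *m S (U m i)).

End Relaxation.

(* Center of cell i and interface i+1/2 of the mesh of cell length dx; the
   origin x0 dx of the mesh may depend on dx. *)
Definition cell_center (R : realType) (x0 : R -> R) (dx : R) (i : int) : R :=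
  x0 dx + i%:~R * dx.

Definition cell_interface (R : realType) (x0 : R -> R) (dx : R) (i : int) : R :=
  cell_center x0 dx i + dx / 2.

(* [err dx i = O(dx)] as dx -> 0, uniformly over the interfaces lying in K. *)
Definition interface_bigO (R : realType) (W : normedModType R) (x0 : R -> R)
    (K : set R) (err : R -> int -> W) : Prop :=
  exists C : R, \forall dx \near 0^'+,
    forall i : int, K (cell_interface x0 dx i) -> `|err dx i| <= C * dx.

Definition discrete_flux (R : realType) (n : nat) (dx : R)
    (M : int -> 'M[R]_n) (u : int -> 'cV[R]_n) (i : int) : 'cV[R]_n :=
  M i *m (dx^-1 *: (u (i + 1) - u i)).

(* Main.v *)
(* Put [tau := lim (alpha / eps) = (2 b / dx) (I + sigma)^-1].  Dividing the
   scheme by eps and letting eps -> 0 gives an identity in which R(U)/eps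
   becomes [B(E(u)) U1]; applying Q kills F(E(u)) and B (condition 3 and the
   derivative of QR = 0), and hypothesis (ii) turns [Q tau] into
   [2 / (b dx) M Q], so that only the diffusive part of the HLL flux survives.

   For consistency, let [Q P = I].  Condition 4 makes [H = B + P Q] invertible,
   and whenever [Q w = 0] the system [B U1 = w], [Q U1 = 0] amounts to
   [H U1 = w]; hence [M(u) = Q A H^-1 A E'(u)], which is continuous, hence
   bounded along a smooth path over a compact set.  The rest is the mean value
   theorem applied to the centered difference quotient. *)

Require Import Defs.
From HB Require Import structures.
From mathcomp Require Import all_boot all_order all_algebra.
From mathcomp Require Import all_classical all_reals all_analysis.
From mathcomp Require Import ring lra.

Set Implicit Arguments.
Unset Strict Implicit.
Unset Printing Implicit Defensive.

Import Order.TTheory GRing.Theory Num.Theory.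
Import numFieldNormedType.Exports.

Local Open Scope classical_set_scope.
Local Open Scope ring_scope.

(** * Limits of sums, products, determinants and inverses of matrices *)

Lemma cvg_sum_fin (R : realType) (T I : Type) (F : set_system T) {FF : Filter F}
    (r : seq I) (f : I -> T -> R) (L : I -> R) :
  (forall i, f i x @[x --> F] --> L i) ->
  \sum_(i <- r) f i x @[x --> F] --> \sum_(i <- r) L i.
Proof.
move=> fL; apply: (@cvg_big R I +%R 0 xpredT _ T F r f L FF (fun i _ => fL i)).
exact: (@add_continuous R^o).
Qed.

Lemma cvg_prod_fin (R : realType) (T I : Type) (F : set_system T)
    {FF : Filter F} (r : seq I) (f : I -> T -> R) (L : I -> R) :
  (forall i, f i x @[x --> F] --> L i) ->
  \prod_(i <- r) f i x @[x --> F] --> \prod_(i <- r) L i.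
Proof.
move=> fL; apply: (@cvg_big R I *%R 1 xpredT _ T F r f L FF (fun i _ => fL i)).
exact: mul_continuous.
Qed.

(** The matrix norm is a maximum over finitely many entries, so the eventual bounds on the entries
    can be intersected into one. *)
Lemma cvg_mx (R : realType) (T : Type) (F : set_system T) {FF : Filter F}
    (p q : nat) (f : T -> 'M[R]_(p, q)) (L : 'M[R]_(p, q)) :
  (forall i j, f x i j @[x --> F] --> L i j) -> f x @[x --> F] --> L.
Proof.
move=> fL; apply/cvgrPdist_le => e e0; near=> x.
rewrite [leLHS]/Num.Def.normr/= mx_normrE (bigmax_le _ (ltW e0))//= => i _.
rewrite !mxE; move: i; near: x; apply: filter_forall => /= i.
exact: ((cvgrPdist_le _ _).1 (fL i.1 i.2)).
Unshelve. all: by end_near. Qed.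

Lemma cvg_coord (R : realType) (T : Type) (F : set_system T) {FF : Filter F}
    (p q : nat) (f : T -> 'M[R]_(p, q)) (L : 'M[R]_(p, q)) i j :
  f x @[x --> F] --> L -> f x i j @[x --> F] --> L i j.
Proof.
by move=> fL; exact: (cvg_comp _ _ fL (@coord_continuous _ p q i j L)).
Qed.

Lemma cvg_mulmx (R : realType) (T : Type) (F : set_system T) {FF : Filter F}
    (p q r : nat) (f : T -> 'M[R]_(p, q)) (g : T -> 'M[R]_(q, r))
    (Lf : 'M[R]_(p, q)) (Lg : 'M[R]_(q, r)) :
  f x @[x --> F] --> Lf -> g x @[x --> F] --> Lg ->
  f x *m g x @[x --> F] --> Lf *m Lg.
Proof.
move=> fL gL; apply: cvg_mx => i j.
rewrite mxE; under eq_cvg do rewrite mxE.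
by apply: cvg_sum_fin => k; apply: cvgM; exact: cvg_coord.
Qed.

Lemma cvg_det (R : realType) (T : Type) (F : set_system T) {FF : Filter F}
    (p : nat) (f : T -> 'M[R]_p) (L : 'M[R]_p) :
  f x @[x --> F] --> L -> \det (f x) @[x --> F] --> \det L.
Proof.
move=> fL; rewrite /determinant.
apply: cvg_sum_fin => s; apply: cvgM; first exact: cvg_cst.
by apply: cvg_prod_fin => k; exact: cvg_coord.
Qed.

Lemma near_unitmx (R : realType) (T : Type) (F : set_system T) {FF : Filter F}
    (p : nat) (f : T -> 'M[R]_p) (L : 'M[R]_p) :
  L \in unitmx -> f x @[x --> F] --> L -> \forall x \near F, f x \in unitmx.
Proof.
move=> Lu fL; have dL : \det (f x) @[x --> F] --> \det L by exact: cvg_det.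
have d0 : \det L != 0 by rewrite -unitfE -unitmxE.
by near=> x; rewrite unitmxE unitfE; near: x; exact: (cvgr_neq0 _ dL d0).
Unshelve. all: by end_near. Qed.

Lemma cvg_invmx (R : realType) (T : Type) (F : set_system T) {FF : Filter F}
    (p : nat) (f : T -> 'M[R]_p) (L : 'M[R]_p) :
  L \in unitmx -> f x @[x --> F] --> L -> invmx (f x) @[x --> F] --> invmx L.
Proof.
move=> Lu fL; have dL : \det (f x) @[x --> F] --> \det L by exact: cvg_det.
have d0 : \det L != 0 by rewrite -unitfE -unitmxE.
have adjL : \adj (f x) @[x --> F] --> \adj L.
  apply: cvg_mx => i j; rewrite mxE; under eq_cvg do rewrite mxE.
  apply: cvgM; first exact: cvg_cst.
  apply: cvg_det; apply: cvg_mx => k l; rewrite !mxE.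
  by under eq_cvg do rewrite !mxE; exact: cvg_coord.
have dV : (\det (f x))^-1 @[x --> F] --> (\det L)^-1 by exact: (cvgV d0 dL).
(* [invmx] is the adjugate formula only on invertible matrices and returns its argument elsewhere;
   by openness of invertibility the formula holds eventually. *)
rewrite [X in _ --> X]/invmx Lu; apply: cvg_trans (cvgZ dV adjL).
apply: near_eq_cvg; near=> x.
by rewrite /invmx ifT//; near: x; exact: (near_unitmx Lu fL).
Unshelve. all: by end_near. Qed.

(** * Differentials on column vectors and differentiation of linear constraints *)

Lemma diff_jacE (R : realType) (p q : nat) (f : 'cV[R]_p -> 'cV[R]_q) x v :
  'd f x v = jac f x *m v.
Proof.
rewrite [in LHS](matrix_sum_delta v) linear_sum/=; apply/colP => i.
rewrite summxE !mxE; apply: eq_bigr => j _.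
by rewrite big_ord1 linearZ/= !mxE mulrC.
Qed.

Lemma cvg_near_eq (R : realType) (V : normedModType R) (T : Type)
    (F : set_system T) {FF : ProperFilter F} (f : T -> V) (l c : V) :
  f x @[x --> F] --> l -> (\forall x \near F, f x = c) -> l = c.
Proof.
move=> fl fc; apply: (cvg_unique (@norm_hausdorff _ V) fl).
exact: cvg_near_cst.
Qed.

(** Small difference quotients of [g] are killed by [Q], hence so is their limit. With [g = S] this
    yields [Q B = 0]; with [g = F \o E] it yields [Q A E' = 0]. *)
Lemma mulmx_diff_near0 (R : realType) (V : normedModType R) (p q : nat)
    (Q : 'M[R]_(q, p)) (g : V -> 'cV[R]_p) (x v : V) :
  differentiable g x -> (\forall y \near x, Q *m g y = 0) ->
  Q *m 'd g x v = 0.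
Proof.
move=> dg Qg0; rewrite -deriveE//.
have Dg : h^-1 *: (g (h *: v + x) - g x) @[h --> 0^'] --> 'D_v g x.
  exact: (@diff_derivable _ _ _ g x v dg).
have QDg : Q *m (h^-1 *: (g (h *: v + x) - g x)) @[h --> 0^'] --> Q *m 'D_v g x.
  by apply: cvg_mulmx => //; exact: cvg_cst.
apply: (cvg_near_eq QDg); near=> h.
rewrite -scalemxAr mulmxBr (nbhs_singleton Qg0) subr0.
suff -> : Q *m g (h *: v + x) = 0 by rewrite scaler0.
near: h; suff cv : h *: v + x @[h --> 0^'] --> x by exact: (cv _ Qg0).
rewrite -[X in _ --> X]add0r -[X in X + _](scale0r v).
apply: cvgD; last exact: cvg_cst.
by apply: cvgZr_tmp; exact: nbhs_dnbhs.
Unshelve. all: by end_near. Qed.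

(** * The limit of the scheme as [eps] tends to 0 *)

Lemma scaled_alpha_cvg (R : realType) (N : nat) (b dx : R) (s : 'M[R]_N) :
  0 < b -> 0 < dx -> 1%:M + s \in unitmx ->
  eps^-1 *: alpha_mx b dx eps s @[eps --> 0^'+]
    --> (2 * b / dx) *: invmx (1%:M + s).
Proof.
(* The factor [eps^-1] is absorbed into the inverse: [eps^-1 *: alpha] is the inverse of
   [G eps = eps I + c (I + s)], which is regular at [eps = 0], with invertible limit [c (I + s)]. *)
move=> b0 dx0 su; set c := dx / (2 * b).
have c0 : 0 < c by rewrite divr_gt0// mulr_gt0.
pose G (eps : R) : 'M[R]_N := eps *: 1%:M + c *: (1%:M + s).
have GL : G eps @[eps --> 0^'+] --> c *: (1%:M + s).
  have -> : c *: (1%:M + s) = (0 : R) *: 1%:M + c *: (1%:M + s).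
    by rewrite scale0r add0r.
  apply: cvgD; last exact: cvg_cst.
  by apply: cvgZr_tmp; exact: cvg_at_right_filter.
have Lu : c *: (1%:M + s) \in unitmx by rewrite unitmxZ// unitfE gt_eqF.
have -> : 2 * b / dx = c^-1 by rewrite /c invf_div.
rewrite -invmxZ; last by [].
apply: cvg_trans (cvg_invmx Lu GL); apply: near_eq_cvg; near=> eps.
have e0 : 0 < eps by near: eps; exact: nbhs_right_gt.
have GE : G eps = eps *: (1%:M + (dx / (2 * eps * b)) *: (1%:M + s)).
  rewrite /G [RHS]scalerDr scalerA; congr (_ + _ *: _).
  by rewrite /c; field; rewrite !gt_eqF.
have Gu : G eps \in unitmx by near: eps; exact: (near_unitmx Lu GL).
by rewrite /alpha_mx GE invmxZ// -GE.
Unshelve. all: by end_near. Qed.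

Lemma expansion_cvg (R : realType) (V : normedModType R) (U : R -> V)
    (a v : V) :
  U = (fun eps : R => a + eps *: v) +O_ (0^'+) (fun eps : R => eps ^+ 2) ->
  eps^-1 *: (U eps - a) @[eps --> 0^'+] --> v.
Proof.
move=> /eqaddOP; rewrite /= => -[k0 [_ Hk]].
(* The big-O bound is available for every constant above [k0]; the maximum with 1 makes it positive,
   so that [eps <= e / k] can be imposed. *)
pose k := Num.max (k0 + 1) 1.
have kk0 : k0 < k by rewrite lt_max ltrDl ltr01.
have k_gt0 : 0 < k by rewrite lt_max ltr01 orbT.
have {}Hk := Hk k kk0.
apply/cvgrPdist_le => e e0; near=> eps.
have eps0 : 0 < eps by near: eps; exact: nbhs_right_gt.
have : eps <= e / k by near: eps; apply: nbhs_right_le; exact: divr_gt0.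
rewrite ler_pdivlMr// => ek.
have : `|U eps - (a + eps *: v)| <= k * `|eps ^+ 2| by near: eps.
have -> : v - eps^-1 *: (U eps - a) = - (eps^-1 *: (U eps - (a + eps *: v))).
  rewrite opprD addrA [in RHS]scalerBr scalerA mulVf ?gt_eqF//.
  by rewrite scale1r opprB.
rewrite (gtr0_norm (exprn_gt0 2 eps0)) => H.
rewrite normrN normrZ gtr0_norm ?invr_gt0//.
rewrite ler_pdivrMl//; apply: le_trans H _.
by rewrite expr2 mulrCA ler_pM2l// mulrC.
Unshelve. all: by end_near. Qed.

(** Chain rule along a curve known only to first order for [eps > 0]. The continuous map ['d f a]
    carries the quotient to its limit, and the remainder [r] vanishes because it is [eps^-1] times a
    little-o of [U eps - a], itself of order [eps]. *)
Lemma expansion_comp_cvg (R : realType) (V W : normedModType R) (f : V -> W)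
    (U : R -> V) (a v : V) :
  differentiable f a -> eps^-1 *: (U eps - a) @[eps --> 0^'+] --> v ->
  eps^-1 *: (f (U eps) - f a) @[eps --> 0^'+] --> 'd f a v.
Proof.
move=> df Uv.
have dfc : continuous ('d f a) by exact: diff_continuous.
have Ua : U eps - a @[eps --> 0^'+] --> 0.
  have : eps *: (eps^-1 *: (U eps - a)) @[eps --> 0^'+] --> 0 *: v.
    by apply: cvgZ => //; exact: cvg_at_right_filter.
  rewrite scale0r; apply: cvg_trans; apply: near_eq_cvg; near=> eps.
  by rewrite scalerA mulfV ?scale1r// gt_eqF//; near: eps; exact: nbhs_right_gt.
have dU : 'd f a (eps^-1 *: (U eps - a)) @[eps --> 0^'+] --> 'd f a v.
  exact: (continuous_cvg _ (dfc v) Uv).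
rewrite -[X in _ --> X]addr0.
pose r eps := eps^-1 *: (f (U eps) - f a) - 'd f a (eps^-1 *: (U eps - a)).
have rE : (fun eps => eps^-1 *: (f (U eps) - f a)) =
    (fun eps => 'd f a (eps^-1 *: (U eps - a)) + r eps).
  by apply/funext => eps; rewrite /r subrKC.
rewrite rE; apply: cvgD => //.
apply/cvgr0Pnorm_le => e e0.
(* The quotient is eventually of norm at most [|v| + 1], so a remainder bounded by [d] times the
   increment contributes at most [d (|v| + 1) = e]. *)
set d := e / (`|v| + 1).
have v1 : 0 < `|v| + 1 by rewrite ltr_wpDl.
have d0 : 0 < d by rewrite divr_gt0.
have /eqaddoP/(_ d d0) Hd :
    (fun h => f (h + a)) = (fun h => f a + 'd f a h) +o_ 0 id.
  by apply/funext => h; have := diff_locallyx df h.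
have Hdu := Ua _ Hd.
near=> eps.
have eps0 : 0 < eps by near: eps; exact: nbhs_right_gt.
have : `|f ((U eps - a) + a) - (f a + 'd f a (U eps - a))| <= d * `|U eps - a|.
  by near: eps.
rewrite subrK => H.
have -> : r eps = eps^-1 *: (f (U eps) - (f a + 'd f a (U eps - a))).
  by rewrite /r linearZ/= -scalerBr opprD addrA.
rewrite normrZ gtr0_norm ?invr_gt0// ler_pdivrMl//; apply: le_trans H _.
have : `|eps^-1 *: (U eps - a)| <= `|v| + 1.
  near: eps; apply: cvgr_norm_le Uv _ _.
  by rewrite ltrDl.
rewrite normrZ gtr0_norm ?invr_gt0// ler_pdivrMl// => H.
rewrite -(ler_pM2l d0) in H; apply: le_trans H _.
by rewrite /d mulrCA ler_pM2l// divfK// gt_eqF.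
Unshelve. all: by end_near. Qed.

Lemma eps_scheme_limit (R : realType) (n N : nat)
    (F S : 'cV[R]_N -> 'cV[R]_N) (b dx dt : R) (sigma : nat -> int -> 'M[R]_N)
    (U : R -> nat -> int -> 'cV[R]_N) (V : nat -> int -> 'cV[R]_N)
    (U1 : nat -> int -> 'cV[R]_N) :
  0 < b -> 0 < dx ->
  (forall m i, 1%:M + sigma m i \in unitmx) ->
  (forall m i, {for V m i, continuous F}) ->
  (forall m i, differentiable S (V m i)) ->
  (forall m i, S (V m i) = 0) ->
  (forall eps, 0 < eps <= 1 -> eps_scheme F S b dx dt eps sigma (U eps)) ->
  (forall m i, (fun eps : R => U eps m i)
     = (fun eps : R => V m i + eps *: U1 m i)
       +O_ (0^'+) (fun eps : R => eps ^+ 2)) ->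
  forall m i,
    let tau j := (2 * b / dx) *: invmx (1%:M + sigma m j) in
    dt^-1 *: (V m.+1 i - V m i)
    + dx^-1 *: (tau i *m hll_flux F b (V m i) (V m (i + 1))
                - tau (i - 1) *m hll_flux F b (V m (i - 1)) (V m i))
    = dx^-1 *: ((tau i - tau (i - 1)) *m F (V m i))
      - 2^-1 *: ((tau i + tau (i - 1)) *m 'd S (V m i) (U1 m i)).
Proof.
move=> b0 dx0 su Fc Sd S0 scheme expU m i tau; apply/subr0_eq.
have U1L k j := expansion_cvg (expU k j).
have UL k j : U eps k j @[eps --> 0^'+] --> V k j.
  have : eps *: (eps^-1 *: (U eps k j - V k j)) + V k j @[eps --> 0^'+]
      --> 0 *: U1 k j + V k j.
    apply: cvgD; last exact: cvg_cst.
    by apply: cvgZ => //; exact: cvg_at_right_filter.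
  rewrite scale0r add0r; apply: cvg_trans; apply: near_eq_cvg; near=> eps.
  have e0 : 0 < eps by near: eps; exact: nbhs_right_gt.
  by rewrite scalerA mulfV ?gt_eqF// scale1r subrK.
have FL k j : F (U eps k j) @[eps --> 0^'+] --> F (V k j).
  exact: (continuous_cvg _ (Fc k j) (UL k j)).
(* Since [S] vanishes at [V k j], [S / eps] is a difference quotient and the stiff source stays
   bounded. *)
have SL k j : eps^-1 *: S (U eps k j) @[eps --> 0^'+] --> 'd S (V k j) (U1 k j).
  have := expansion_comp_cvg (Sd k j) (U1L k j).
  by under eq_cvg do rewrite S0 subr0.
have HL k j l : hll_flux F b (U eps k j) (U eps k l) @[eps --> 0^'+]
    --> hll_flux F b (V k j) (V k l).
  rewrite /hll_flux; apply: cvgB; apply: cvgZl_tmp; first exact: cvgD.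
  exact: cvgB.
pose a eps j := eps^-1 *: alpha_mx b dx eps (sigma m j).
have aL j : a eps j @[eps --> 0^'+] --> tau j by exact: scaled_alpha_cvg.
(* [lhs] and [rhs] are the two sides of the scheme divided by [eps]. In the source,
   [alpha S / (2 eps^2)] is split as half of [(alpha / eps) (S / eps)], so that each factor
   converges. *)
pose lhs eps := dt^-1 *: (U eps m.+1 i - U eps m i)
    + dx^-1 *: (a eps i *m hll_flux F b (U eps m i) (U eps m (i + 1))
                - a eps (i - 1) *m hll_flux F b (U eps m (i - 1)) (U eps m i)).
pose rhs eps := dx^-1 *: ((a eps i - a eps (i - 1)) *m F (U eps m i))
      - 2^-1 *: ((a eps i + a eps (i - 1)) *m (eps^-1 *: S (U eps m i))).
apply: (@cvg_near_eq _ _ _ (0^'+) _ (fun eps => lhs eps - rhs eps)).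
  rewrite /lhs /rhs; apply: cvgB; [apply: cvgD | apply: cvgB]; apply: cvgZl_tmp.
  - exact: cvgB.
  - by apply: cvgB; apply: cvg_mulmx.
  - by apply: cvg_mulmx => //; apply: cvgB.
  - by apply: cvg_mulmx => //; apply: cvgD.
near=> eps; apply/eqP; rewrite subr_eq0; apply/eqP.
have e0 : 0 < eps by near: eps; exact: nbhs_right_gt.
have e1 : eps <= 1 by near: eps; exact: nbhs_right_le.
have en0 : eps != 0 by rewrite gt_eqF.
have /= sch := scheme eps _ m i; rewrite e0 e1 in sch; have {}sch := sch isT.
have -> : rhs eps = eps^-1 *: (dx^-1 *: ((alpha_mx b dx eps (sigma m i)
      - alpha_mx b dx eps (sigma m (i - 1))) *m F (U eps m i))
    - (2 * eps)^-1 *: ((alpha_mx b dx eps (sigma m i)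
      + alpha_mx b dx eps (sigma m (i - 1))) *m S (U eps m i))).
  rewrite /rhs /a -scalerBr -scalerDr -scalemxAl -scalemxAr -scalemxAl.
  rewrite [RHS]scalerBr !scalerA; congr (_ *: _ - _ *: _).
    by rewrite mulrC.
  by field.
rewrite -sch /lhs /a -!scalemxAl -scalerBr.
rewrite [RHS]scalerDr !scalerA; congr (_ *: _ + _ *: _); last by rewrite mulrC.
by rewrite mulrA mulVf// mul1r.
Unshelve. all: by end_near. Qed.

(** Here [V] stands for [E(u)], [tl] and [tr] for the limits [tau], and [L] for [B U1]. Moving [Q]
    through [tau] turns it into a multiple of [M Q], which annihilates [F] and [L] and leaves only
    the viscous term of the HLL flux. *)
Lemma projected_limit_scheme (R : realType) (n N : nat) (Q : 'M[R]_(n, N))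
    (F : 'cV[R]_N -> 'cV[R]_N) (b dx dt : R) (Vl V Vr V' L : 'cV[R]_N)
    (tl tr : 'M[R]_N) (Ml Mr : 'M[R]_n) :
  0 < b -> 0 < dx ->
  Q *m tl = (2 / (dx * b)) *: (Ml *m Q) ->
  Q *m tr = (2 / (dx * b)) *: (Mr *m Q) ->
  Q *m F Vl = 0 -> Q *m F V = 0 -> Q *m F Vr = 0 -> Q *m L = 0 ->
  dt^-1 *: (V' - V)
    + dx^-1 *: (tr *m hll_flux F b V Vr - tl *m hll_flux F b Vl V)
    = dx^-1 *: ((tr - tl) *m F V) - 2^-1 *: ((tr + tl) *m L) ->
  dt^-1 *: (Q *m V' - Q *m V)
    = (dx ^+ 2)^-1 *: (Mr *m (Q *m Vr - Q *m V) + Ml *m (Q *m Vl - Q *m V)).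
Proof.
move=> b0 dx0 Ql Qr Fl F0 Fr QL /(congr1 (mulmx Q)).
have hllQ W W' : Q *m F W = 0 -> Q *m F W' = 0 ->
    Q *m hll_flux F b W W' = (- (b / 2)) *: (Q *m W' - Q *m W).
  move=> FW FW'; rewrite /hll_flux mulmxBr -!scalemxAr mulmxDr FW FW' addr0.
  by rewrite scaler0 sub0r mulmxBr scaleNr.
have QtE (t : 'M[R]_N) (M : 'M[R]_n) (x : 'cV[R]_N) :
    Q *m t = (2 / (dx * b)) *: (M *m Q) ->
    Q *m (t *m x) = (2 / (dx * b)) *: (M *m (Q *m x)).
  by move=> Qt; rewrite mulmxA Qt -scalemxAl mulmxA.
have Ql' x := QtE _ _ x Ql; have Qr' x := QtE _ _ x Qr.
have := hllQ _ _ F0 Fr; have := hllQ _ _ Fl F0.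
move: (hll_flux F b V Vr) (hll_flux F b Vl V) => hr hl Hl Hr H.
move: H; rewrite !(mulmxBl, mulmxDl) !(mulmxBr Q, mulmxDr Q, =^~ scalemxAr).
rewrite !(Ql', Qr') Hl Hr F0 QL.
rewrite !mulmx0 !scaler0 subrr addr0 !scaler0 subr0.
move=> /eqP; rewrite addr_eq0 => /eqP->.
(* The scalars combine as [(1/dx) (2/(dx b)) (b/2) = 1/dx^2]. *)
rewrite -!scalemxAr !scalerA -scalerBr scalerA -scaleNr; congr (_ *: _).
  by field; rewrite !gt_eqF.
by rewrite -[- (Ml *m _)]mulmxN opprB.
Qed.

(** * Closed form and continuity of the effective matrix *)

Lemma near_omega (R : realType) (n N : nat) (Omega : set 'cV[R]_N)
    (Q : 'M[R]_(n, N)) (u : 'cV[R]_n) :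
  open Omega -> \rank Q = n -> omega Omega Q u ->
  \forall v \near u, omega Omega Q v.
Proof.
move=> oO rQ [U OU QU].
have /row_freeP[P QP] : row_free Q by rewrite /row_free rQ.
have FF : Filter (nbhs u) by apply: nbhs_filter.
(* With [Q P = I], the point [U + P (v - u)] is a preimage of [v] depending continuously on [v], so
   it stays in the open set [Omega]. *)
have wc : U + P *m (v - u) @[v --> u] --> U.
  have Pvu : P *m (v - u) @[v --> u] --> P *m (u - u).
    apply: cvg_mulmx; first by apply: cvg_cst.
    by apply: cvgB; [apply: cvg_id|apply: cvg_cst].
  have := cvgD (cvg_cst U) Pvu; rewrite subrr mulmx0 addr0; exact.
near=> v; exists (U + P *m (v - u)).
  by near: v; exact: (wc _ (open_nbhs_nbhs (conj oO OU))).
by rewrite mulmxDr mulmxA QP mul1mx QU subrKC.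
Unshelve. all: by end_near. Qed.

(** Injectivity of [H = B + P Q], read on transposes: applying [Q] to [H v = 0] gives [Q v = 0],
    hence [B v = 0]. As the kernel of [Q] is the image of [B], [v] lies in both the kernel and the
    image of [B], which meet trivially. *)
Lemma unitmx_corrector (R : fieldType) (n N : nat) (Q : 'M[R]_(n, N))
    (P : 'M[R]_(N, n)) (B : 'M[R]_N) :
  Q *m P = 1%:M -> Q *m B = 0 -> \rank Q = n -> \rank (kermx B^T) = n ->
  (kermx B^T :&: B^T)%MS = 0 -> B + P *m Q \in unitmx.
Proof.
move=> QP QB rQ rB cap0; rewrite -unitmx_tr -row_free_unit.
apply: inj_row_free => v; rewrite linearD/= trmx_mul mulmxDr => vH.
have vQ : v *m Q^T = 0.
  have := congr1 (mulmx^~ Q^T) vH; rewrite /= mulmxDl -!mulmxA -!trmx_mul.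
  by rewrite QB trmx0 mulmx0 add0r QP mul1mx mul0mx.
have vB : v *m B^T = 0 by move: vH; rewrite mulmxA vQ mul0mx addr0.
have BQ : (B^T <= kermx Q^T)%MS by apply/sub_kermxP; rewrite -trmx_mul QB trmx0.
(* The image of [B] lies in the kernel of [Q], and both have dimension [N - n]. *)
have QB' : (kermx Q^T <= B^T)%MS.
  have [_ <-] := mxrank_leqif_sup BQ; rewrite mxrank_ker !mxrank_tr rQ.
  by rewrite -rB mxrank_ker mxrank_tr subKn ?rank_leq_row.
apply/eqP; rewrite -submx0 -cap0 sub_capmx; apply/andP; split.
  exact/sub_kermxP.
by apply: submx_trans QB'; exact/sub_kermxP.
Qed.

(** [Q B = 0] and [Q P = I] give [Q H = Q]; thus [H x = w] forces [Q x = Q w = 0], after which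
    [H x = B x]. *)
Lemma corrector_solP (R : fieldType) (n N : nat) (Q : 'M[R]_(n, N))
    (P : 'M[R]_(N, n)) (B : 'M[R]_N) (w x : 'cV[R]_N) :
  Q *m P = 1%:M -> Q *m B = 0 -> B + P *m Q \in unitmx -> Q *m w = 0 ->
  (B *m x = w /\ Q *m x = 0) <-> x = invmx (B + P *m Q) *m w.
Proof.
set H := B + P *m Q => QP QB Hu Qw; split=> [[Bx Qx]|->].
  by rewrite -[LHS](mulKmx Hu) mulmxDl -mulmxA Qx mulmx0 addr0 Bx.
have QU : Q *m (invmx H *m w) = 0.
  have QH : Q *m H = Q by rewrite mulmxDr QB add0r mulmxA QP mul1mx.
  by rewrite -[X in X *m (_ *m _)]QH -mulmxA mulKVmx.
split=> //; have -> : B = H - P *m Q by rewrite addrK.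
by rewrite mulmxBl mulKVmx// -mulmxA QU mulmx0 subr0.
Qed.

(** Unique solvability removes both uses of [get] and exposes the dependence on [u], as needed for
    continuity. *)
Lemma effective_mxE (R : realType) (n N : nat) (F S : 'cV[R]_N -> 'cV[R]_N)
    (E : 'cV[R]_n -> 'cV[R]_N) (Q : 'M[R]_(n, N)) (P : 'M[R]_(N, n))
    (u : 'cV[R]_n) :
  Q *m P = 1%:M -> Q *m jac S (E u) = 0 ->
  jac S (E u) + P *m Q \in unitmx ->
  (forall p : 'cV[R]_n, Q *m (jac F (E u) *m (jac E u *m p)) = 0) ->
  effective_mx F S E Q u
    = Q *m (jac F (E u) *m
        (invmx (jac S (E u) + P *m Q) *m (jac F (E u) *m jac E u))).
Proof.
rewrite /effective_mx /first_corrector /is_first_corrector.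
move: (jac F (E u)) (jac S (E u)) (jac E u) => A B J QP QB Hu QAJ.
have U1E p : get (fun x : 'cV[R]_N => B *m x = - (A *m (J *m p)) /\ Q *m x = 0)
    = invmx (B + P *m Q) *m (- (A *m (J *m p))).
  have Qw : Q *m - (A *m (J *m p)) = 0 by rewrite mulmxN QAJ oppr0.
  have sol x := corrector_solP x QP QB Hu Qw.
  by apply: get_subset1 => [|x y /sol-> /sol->//]; apply/sol.
apply: get_subset1 => [p|M1 M2 H1 H2].
  by rewrite U1E !mulmxN opprK !mulmxA.
(* Uniqueness of the matrix: columns are compared by taking [p] to be a basis vector. *)
apply/matrixP => i j.
have := congr1 (fun v : 'cV[R]_n => v i 0)
  (etrans (esym (H1 (delta_mx j 0))) (H2 _)).
by rewrite -!colE !mxE.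
Qed.

Lemma jac_cvg (R : realType) (T : topologicalType) (p q : nat)
    (D : set 'cV[R]_p) (f : 'cV[R]_p -> 'cV[R]_q) (w : T -> 'cV[R]_p) (x : T) :
  smooth_on D f -> (forall y, D (w y)) -> w y @[y --> x] --> w x ->
  jac f (w y) @[y --> x] --> jac f (w x).
Proof.
move=> sf Dw wc; have [fd fD] := sf 1%N.
apply: cvg_mx => i j; pose g y := 'D_(delta_mx j 0) f (w y) i 0.
have gc : g y @[y --> x] --> g x.
  apply: cvg_coord.
  exact: (continuous_cvg (nbhs_filter x) (fD (delta_mx j 0) _ (Dw x)) wc).
have jg : (fun y => jac f (w y) i j) = g.
  by apply/funext => y; rewrite /g mxE deriveE//; exact: fd.
by move: gc; rewrite -jg.
Qed.

Lemma mulmx_cV_eq0 (R : fieldType) (p q : nat) (A : 'M[R]_(p, q)) :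
  (forall v : 'cV[R]_q, A *m v = 0) -> A = 0.
Proof.
move=> A0; apply/matrixP => i j.
have := congr1 (fun v : 'cV[R]_p => v i 0) (A0 (delta_mx j 0)).
by rewrite -colE !mxE.
Qed.

Lemma effective_mx_cvg (R : realType) (n N : nat) (Omega : set 'cV[R]_N)
    (F S : 'cV[R]_N -> 'cV[R]_N) (Q : 'M[R]_(n, N)) (E : 'cV[R]_n -> 'cV[R]_N)
    (T : topologicalType) (w : T -> 'cV[R]_n) (x : T) :
  open Omega -> smooth_on Omega F -> smooth_on Omega S ->
  condition1 Omega S Q -> condition2 Omega S E Q ->
  condition3 Omega F E Q -> condition4 Omega S E Q ->
  (forall y, omega Omega Q (w y)) -> w y @[y --> x] --> w x ->
  effective_mx F S E Q (w y) @[y --> x] --> effective_mx F S E Q (w x).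
Proof.
move=> oO sF sS [_ rQ QS] [sE E2] C3 C4 ww wc.
have /row_freeP[P QP] : row_free Q by rewrite /row_free rQ.
have OE u : omega Omega Q u -> Omega (E u) by move=> /E2[].
have QB u : omega Omega Q u -> Q *m jac S (E u) = 0.
  move=> ou; apply: mulmx_cV_eq0 => v; rewrite -mulmxA -diff_jacE.
  apply: mulmx_diff_near0; first exact: (sS 1%N).1 _ (OE _ ou).
  by apply: filterS (open_nbhs_nbhs (conj oO (OE _ ou))) => U /QS.
have Hu u : omega Omega Q u -> jac S (E u) + P *m Q \in unitmx.
  move=> ou; have [rB cap0] := C4 _ ou.
  exact: unitmx_corrector QP (QB _ ou) rQ rB cap0.
(* Condition 3 is differentiated on [omega], which is open; this places the right-hand side of the
   corrector system in the kernel of [Q]. *)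
have QAJ u : omega Omega Q u ->
    forall p : 'cV[R]_n, Q *m (jac F (E u) *m (jac E u *m p)) = 0.
  move=> ou p; rewrite -!diff_jacE.
  have dE : differentiable E u by exact: (sE 1%N).1.
  have dF : differentiable F (E u) by apply: (sF 1%N).1; exact: OE.
  have dFE : 'd (F \o E) u p = 'd F (E u) ('d E u p) :=
    congr1 (fun g => g p) (diff_comp dE dF).
  rewrite -dFE; apply: mulmx_diff_near0; first exact: differentiable_comp.
  by apply: filterS (near_omega oO rQ ou) => v /C3.
have EE u : omega Omega Q u -> _ := fun ou =>
  effective_mxE QP (QB _ ou) (Hu _ ou) (QAJ _ ou).
have FF : Filter (nbhs x) by apply: nbhs_filter.
have wE : E (w y) @[y --> x] --> E (w x).
  apply: (continuous_cvg FF _ wc); apply: differentiable_continuous.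
  exact: (sE 1%N).1 _ (ww x).
have OEw y : Omega (E (w y)) by exact: OE.
have Ac := jac_cvg sF OEw wE; have Bc := jac_cvg sS OEw wE.
have Jc := jac_cvg sE ww wc.
have -> : (fun y => effective_mx F S E Q (w y)) = (fun y =>
   Q *m (jac F (E (w y)) *m (invmx (jac S (E (w y)) + P *m Q)
     *m (jac F (E (w y)) *m jac E (w y))))).
  by apply/funext => y; exact: EE.
have Hc : invmx (jac S (E (w y)) + P *m Q) @[y --> x]
    --> invmx (jac S (E (w x)) + P *m Q).
  by apply: (cvg_invmx (Hu _ (ww x))); apply: (cvgD Bc); apply: cvg_cst.
rewrite (EE _ (ww x)).
have Qc : Q @[y --> x] --> Q by apply: cvg_cst.
exact: (cvg_mulmx Qc (cvg_mulmx Ac (cvg_mulmx Hc (cvg_mulmx Ac Jc)))).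
Qed.

(** * Norm bounds and consistency of the discrete flux *)

Lemma bounded_on_segment (R : realType) (V : normedModType R) (f : R -> V)
    (r : R) :
  continuous f -> exists C, forall x, `|x| <= r -> `|f x| <= C.
Proof.
move=> fc.
have cI : compact (f @` `[- r, r]%classic).
  apply: continuous_compact; last exact: segment_compact.
  exact: continuous_subspaceT.
have [M [_ MP]] := compact_bounded cI.
exists (M + 1) => x xr; apply: (MP (M + 1)); first by rewrite ltrDl.
by exists x => //=; rewrite in_itv/= -ler_norml.
Qed.

Lemma mx_norm_le (R : realType) (p q : nat) (A : 'M[R]_(p, q)) (c : R) :
  0 <= c -> (`|A| <= c) <-> (forall i j, `|A i j| <= c).
Proof.
move=> c0; rewrite [X in X <= c]/Num.Def.normr/= mx_normrE.
split=> [/bigmax_leP[_ H] i j|H].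
  exact: (H (i, j)).
by apply: bigmax_le => // -[i j] _; exact: H.
Qed.

Lemma coord_norm_le (R : realType) (p q : nat) (A : 'M[R]_(p, q)) i j :
  `|A i j| <= `|A|.
Proof. by move: i j; apply/mx_norm_le. Qed.

(** The factor [q] appears because the norm is the largest entry and each entry of the product sums
    [q] terms. *)
Lemma mulmx_norm_le (R : realType) (p q r : nat) (A : 'M[R]_(p, q))
    (B : 'M[R]_(q, r)) :
  `|A *m B| <= q%:R * (`|A| * `|B|).
Proof.
apply/mx_norm_le => [|i j]; first by rewrite !mulr_ge0.
rewrite mxE; apply: le_trans (ler_norm_sum _ _ _) _.
rewrite mulr_natl -[X in _ *+ X]card_ord -sumr_const.
apply: ler_sum => k _; rewrite normrM ler_pM//; exact: coord_norm_le.
Qed.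

Lemma mvt_bound (R : realType) (f df : R -> R) (r C : R) :
  (forall y : R, is_derive y 1 f (df y)) ->
  (forall y, `|y| <= r -> `|df y| <= C) ->
  forall a b, `|a| <= r -> `|b| <= r -> `|f b - f a| <= C * `|b - a|.
Proof.
move=> fd dfC; suff H a b : a <= b -> `|a| <= r -> `|b| <= r ->
    `|f b - f a| <= C * `|b - a|.
  move=> a b; have [ab|/ltW ba] := leP a b; first exact: H.
  by move=> ar br; rewrite distrC [X in _ * X]distrC; exact: H.
move=> ab ar br.
have fc : {within `[a, b], continuous f}.
  by apply: derivable_within_continuous => x _; case: (fd x).
have [c cab ->] := MVT_segment ab (fun x _ => fd x) fc.
rewrite normrM ler_wpM2r//; apply: dfC.
move: cab; rewrite in_itv/= => /andP[ac cb]; rewrite ler_norml.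
move: ar br; rewrite !ler_norml => /andP[ar _] /andP[_ br].
by rewrite (le_trans ar)// (le_trans cb).
Qed.

Lemma is_derive_coord (R : realType) (n : nat) (v : R -> 'cV[R]_n) (i : 'I_n)
    (t : R) :
  derivable v t 1 -> is_derive t 1 (fun y => v y i 0) ('D_1 v t i 0).
Proof.
move=> dv; rewrite (derive_mx dv) mxE; apply: DeriveDef => //.
by move/derivable_mxP : dv => /(_ i 0).
Qed.

(** In each coordinate the quotient equals the derivative at some [c] within [h / 2] of [x], with
    [c] depending on the coordinate; a bound on the second derivative then controls the
    difference. *)
Lemma centered_quotient_bound (R : realType) (n : nat) (v : R -> 'cV[R]_n)
    (r : R) :
  smooth_on setT (v : R^o -> 'cV[R]_n) ->
  exists C, 0 <= C /\ forall x h, `|x| <= r -> 0 < h <= 1 ->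
    `|v^`()%classic x| <= C /\
    `|h^-1 *: (v (x + h / 2) - v (x - h / 2)) - v^`()%classic x| <= C * h.
Proof.
move=> sv; have [vd vD] := sv 2%N; have [d1d d1D] := vD 1.
have Dv y : derivable v y 1 by apply: diff_derivable; exact: vd.
have DDv y : derivable ('D_1 v) y 1 by apply: diff_derivable; exact: d1d.
have c1 : continuous ('D_1 v).
  by move=> y; apply: differentiable_continuous; exact: d1d.
have c2 : continuous ('D_1 ('D_1 v)) by move=> y; exact: (d1D 1).
(* The radius [r + 1] leaves room for [c], since [h <= 1]. *)
have [C1 C1P] := bounded_on_segment (r + 1) c1.
have [C2 C2P] := bounded_on_segment (r + 1) c2.
pose C := Num.max 0 (Num.max C1 C2); exists C.
have C0 : 0 <= C by rewrite le_max lexx.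
have C1C : C1 <= C by rewrite !le_max lexx orbT.
have C2C : C2 <= C by rewrite !le_max lexx !orbT.
split=> // x h xr /andP[h0 h1]; rewrite derive1E; split.
  by apply: le_trans C1C; apply: C1P; rewrite (le_trans xr)// lerDl.
apply/mx_norm_le => [|i j]; first by rewrite mulr_ge0// ltW.
rewrite ord1 !mxE.
have ab : x - h / 2 <= x + h / 2 by lra.
have fd y := is_derive_coord i (Dv y).
have [|c] := MVT_segment ab (fun y _ => fd y).
  by apply: derivable_within_continuous => y _; case: (fd y).
rewrite in_itv/= => /andP[cl cr] ->.
have -> : x + h / 2 - (x - h / 2) = h by field.
rewrite [h^-1 * _]mulrCA mulVf ?gt_eqF// mulr1.
have xcr : `|c| <= r + 1.
  by move: xr; rewrite !ler_norml => /andP[? ?]; apply/andP; split; lra.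
have xr1 : `|x| <= r + 1 by rewrite (le_trans xr)// lerDl.
have dfd y := is_derive_coord i (DDv y).
have bnd y : `|y| <= r + 1 -> `|'D_1 ('D_1 v) y i 0| <= C.
  move=> yr; rewrite (le_trans (coord_norm_le _ _ _))//.
  exact: le_trans (C2P _ yr) C2C.
apply: le_trans (mvt_bound dfd bnd xr1 xcr) _.
by rewrite ler_wpM2l// ler_norml; apply/andP; split; lra.
Qed.

Lemma discrete_flux_consistent (R : realType) (n : nat) (x0 : R -> R)
    (K : set R) (M : R -> int -> 'M[R]_n) (A : R -> 'M[R]_n) (v : R -> 'cV[R]_n) :
  compact K -> continuous A -> smooth_on setT (v : R^o -> 'cV[R]_n) ->
  interface_bigO x0 K (fun dx i => M dx i - A (cell_interface x0 dx i)) ->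
  interface_bigO x0 K (fun dx i =>
    discrete_flux dx (M dx) (fun j => v (cell_center x0 dx j)) i
    - A (cell_interface x0 dx i) *m v^`()%classic (cell_interface x0 dx i)).
Proof.
move=> cK cA sv [C0 MA].
have [r0 [_ Kr0]] := compact_bounded cK; pose r := r0 + 1.
have Kr x : K x -> `|x| <= r by apply: Kr0; rewrite ltrDl.
have [CA CAP] := bounded_on_segment r cA.
have [C [C_ge0 CP]] := centered_quotient_bound r sv.
(* The error splits as [(M - A) q + A (q - v')], with [q] the quotient. For [dx <= 1],
   [|q| <= |v'| + C dx <= C + C], which gives the first term; the second is bounded by [CA] times
   [C dx]. *)
exists (n%:R * (C0 * (C + C)) + n%:R * (CA * C)); near=> dx => i Ki.
have dx0 : 0 < dx by near: dx; exact: nbhs_right_gt.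
have dx1 : dx <= 1 by near: dx; exact: nbhs_right_le.
have MAi : `|M dx i - A (cell_interface x0 dx i)| <= C0 * dx.
  by move: i Ki; near: dx.
have dx01 : 0 < dx <= 1 by rewrite dx0.
have [v1 v2] := CP _ _ (Kr _ Ki) dx01.
(* The interface is the midpoint of the two centers, so the quotient is centered there. *)
have xr : cell_center x0 dx (i + 1) = cell_interface x0 dx i + dx / 2.
  by rewrite /cell_interface /cell_center intrD; field.
have xl : cell_center x0 dx i = cell_interface x0 dx i - dx / 2.
  by rewrite /cell_interface addrK.
move: (Kr _ Ki) MAi v1 v2; rewrite /discrete_flux xr xl.
move: (cell_interface x0 dx i) => x xr' MAi v1 v2.
move: v2; set q := dx^-1 *: _ => v2.
have -> : M dx i *m q - A x *m v^`()%classic x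
    = (M dx i - A x) *m q + A x *m (q - v^`()%classic x).
  by rewrite mulmxBl mulmxBr addrA subrK.
rewrite mulrDl (le_trans (ler_normD _ _))// lerD//.
  rewrite (le_trans (mulmx_norm_le _ _))// -mulrA ler_wpM2l//.
  rewrite mulrAC ler_pM//; rewrite -[q](subrK (v^`()%classic x)).
  rewrite (le_trans (ler_normD _ _))// lerD// (le_trans v2)//.
  by rewrite ler_piMr.
rewrite (le_trans (mulmx_norm_le _ _))// -mulrA ler_wpM2l//.
by rewrite -mulrA ler_pM// CAP.
Unshelve. all: by end_near. Qed.

(** * Combination of the limit scheme with flux consistency *)

Theorem theorem4 (R : realType) (n N : nat)
    (Omega : set 'cV[R]_N) (F S : 'cV[R]_N -> 'cV[R]_N)
    (Q : 'M[R]_(n, N)) (E : 'cV[R]_n -> 'cV[R]_N)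
    (b : R) (x0 : R -> R)
    (sigma : R -> nat -> int -> 'M[R]_N) (M : R -> nat -> int -> 'M[R]_n)
    (ubar : nat -> R -> 'cV[R]_n) (K : set R)
    (Omega_open : open Omega)
    (Omega_convex : convex_set (Omega : set (convex_lmodType 'cV[R]_N)))
    (F_smooth : smooth_on Omega F) (S_smooth : smooth_on Omega S)
    (A_diag : forall U, Omega U -> diagonalizable (jac F U))
    (C1 : condition1 Omega S Q) (C2 : condition2 Omega S E Q)
    (C3 : condition3 Omega F E Q) (C4 : condition4 Omega S E Q)
    (b_gt0 : 0 < b)
    (sigma_unit : forall (dx : R) (m : nat) (i : int), 0 < dx ->
       1%:M + sigma dx m i \in unitmx /\
       forall eps : R, 0 <= eps <= 1 ->
         (1 + 2 * eps * b / dx)%:M + sigma dx m i \in unitmx)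
    (sigma_M : forall (dx : R) (m : nat) (i : int), 0 < dx ->
       Q *m invmx (1%:M + sigma dx m i) = (b ^+ 2)^-1 *: (M dx m i *m Q))
    (ubar_smooth : forall m, smooth_on setT (ubar m : R^o -> 'cV[R]_n))
    (ubar_omega : forall m x, omega Omega Q (ubar m x))
    (K_compact : compact K)
    (M_consistent : forall m : nat,
       interface_bigO x0 K (fun dx i =>
         M dx m i - effective_mx F S E Q (ubar m (cell_interface x0 dx i)))) :
  (forall (dx dt : R) (U : R -> nat -> int -> 'cV[R]_N)
          (u : nat -> int -> 'cV[R]_n) (U1 : nat -> int -> 'cV[R]_N),
     0 < dx -> 0 < dt ->
     (forall eps m i, 0 < eps <= 1 -> Omega (U eps m i)) ->
     (forall eps, 0 < eps <= 1 ->
        eps_scheme F S b dx dt eps (sigma dx) (U eps)) ->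
     (forall m i, omega Omega Q (u m i)) ->
     (forall m i,
        (fun eps : R => U eps m i)
          = (fun eps : R => E (u m i) + eps *: U1 m i)
            +O_ (0^'+) (fun eps : R => eps ^+ 2)) ->
     forall m i,
       dt^-1 *: (u m.+1 i - u m i)
       = (dx ^+ 2)^-1 *: (M dx m i *m (u m (i + 1) - u m i)
                          + M dx m (i - 1) *m (u m (i - 1) - u m i))
       /\
       dt^-1 *: (u m.+1 i - u m i)
       = dx^-1 *: (discrete_flux dx (M dx m) (u m) i
                   - discrete_flux dx (M dx m) (u m) (i - 1)))
  /\
  (forall m : nat,
     interface_bigO x0 K (fun dx i =>
       discrete_flux dx (M dx m) (fun j => ubar m (cell_center x0 dx j)) i
       - effective_mx F S E Q (ubar m (cell_interface x0 dx i))
         *m (ubar m)^`()%classic (cell_interface x0 dx i))).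
Proof.
have [nN rQ QS] := C1; have [sE E2] := C2.
have OE u : omega Omega Q u -> Omega (E u) by move=> /E2[].
split=> [dx dt U u U1 dx0 dt0 OU sch ou expU m i | m]; last first.
  have vc : continuous (ubar m).
    by move=> y; apply: differentiable_continuous; exact: (ubar_smooth m 1%N).1.
  have cA : continuous (fun x => effective_mx F S E Q (ubar m x)).
    move=> y; exact: (effective_mx_cvg Omega_open F_smooth S_smooth
      C1 C2 C3 C4 (ubar_omega m) (vc y)).
  exact: (discrete_flux_consistent K_compact cA (ubar_smooth m)
    (M_consistent m)).
have dF k j : differentiable F (E (u k j)) by apply/(F_smooth 1%N).1/OE.
have dS k j : differentiable S (E (u k j)) by apply/(S_smooth 1%N).1/OE.
have SE k j : S (E (u k j)) = 0 by have [] := E2 _ (ou k j).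
have lim := @eps_scheme_limit R n N F S b dx dt (sigma dx) U
  (fun k j => E (u k j)) U1 b_gt0 dx0 (fun k j => (sigma_unit dx k j dx0).1)
  (fun k j => differentiable_continuous (dF k j)) dS
  SE sch expU m i.
(* Hypothesis (ii) enters here: [(2 b / dx) (1 / b^2) = 2 / (dx b)]. *)
have tauE j : Q *m ((2 * b / dx) *: invmx (1%:M + sigma dx m j))
    = (2 / (dx * b)) *: (M dx m j *m Q).
  rewrite -scalemxAr sigma_M// scalerA; congr (_ *: _).
  by field; rewrite !gt_eqF.
have QdS : Q *m 'd S (E (u m i)) (U1 m i) = 0.
  apply: mulmx_diff_near0 => //.
  by apply: filterS (open_nbhs_nbhs (conj Omega_open (OE _ (ou m i)))) => W /QS.
have QF j : Q *m F (E (u m j)) = 0 by exact: C3.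
have QE k j : Q *m E (u k j) = u k j by have [] := E2 _ (ou k j).
have eq1 := projected_limit_scheme b_gt0 dx0 (tauE (i - 1)) (tauE i)
  (QF _) (QF _) (QF _) QdS lim.
rewrite !QE in eq1; split=> //; rewrite eq1 /discrete_flux subrK.
(* Conservative form: the flux at index [i - 1] uses [u_i - u_(i-1)], so subtracting it restores the
   term [M_(i-1) (u_(i-1) - u_i)]. *)
rewrite -!scalemxAr -scalerBr scalerA -invfM -expr2; congr (_ *: _).
by rewrite -[in RHS]mulmxN opprB.
Qed.
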